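(* Let $p\ge 0$ be an integer and let $\lambda, y$ be real numbers with $|\lambda y|<1$. For $n\ge0$ put $$T_n(y)=e_{\lambda}(y)-1-\frac{(1)_{1,\lambda}}{1!}y-\frac{(1)_{2,\lambda}}{2!}y^{2}-\cdots-\frac{(1)_{n,\lambda}}{n!}y^{n}.$$ Then $$\sum_{n=0}^{\infty}\binom{n}{p}T_n(y)=\frac{y^{p+1}}{(p+1)!}(1)_{p+1,\lambda}(1+\lambda y)^{-(p+1)}e_{\lambda}(y).$$ In particular, if $|\lambda|<1$, $$\sum_{n=0}^{\infty}\binom{n}{p}\bigg(e_{\lambda}(1)-1-\frac{(1)_{1,\lambda}}{1!}-\cdots-\frac{(1)_{n,\lambda}}{n!}\bigg)=\frac{(1)_{p+1,\lambda}}{(p+1)!}(1+\lambda)^{-(p+1)}e_{\lambda}(1).$$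
   Context: For real $\lambda$ the generalized falling factorials are $(x)_{0,\lambda}=1$ and $(x)_{n,\lambda}=x(x-\lambda)\cdots(x-(n-1)\lambda)$ for $n\ge1$. The degenerate exponential is $e_{\lambda}(t)=\sum_{n=0}^{\infty}\frac{(1)_{n,\lambda}}{n!}t^{n}$ (equal to $(1+\lambda t)^{1/\lambda}$ for $\lambda\ne0$, $|\lambda t|<1$, and to $e^t$ for $\lambda=0$). $\binom{n}{p}$ is the usual binomial coefficient (zero when $n<p$). *)

(* Defs.v *)
From Stdlib Require Import Reals Factorial Binomial.
From Coquelicot Require Import Coquelicot.
Open Scope R_scope.

Fixpoint gen_falling (x lambda : R) (n : nat) : R :=
  match n with
  | O => 1
  | S m => gen_falling x lambda m * (x - INR m * lambda)
  end.

Definition deg_exp_coef (lambda : R) (n : nat) : R :=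
  gen_falling 1 lambda n / INR (fact n).

Definition deg_exp (lambda t : R) : R :=
  Series (fun n => deg_exp_coef lambda n * t ^ n).

(* Stdlib's [Binomial.C n p] is not zero for n < p (its n - p is truncated), hence the guard. *)
Definition binom (n p : nat) : R :=
  if Nat.leb p n then Binomial.C n p else 0.

Definition deg_exp_tail (lambda y : R) (n : nat) : R :=
  deg_exp lambda y - sum_f_R0 (fun k => deg_exp_coef lambda k * y ^ k) n.

(* Main.v *)
(** Write [a k] for the [k]-th term of the degenerate exponential series at [y]
    and [T n] for its tail after [n]. Summation by parts and Pascal's rule give
<<
      sum_(n <= N) C(n,p) T n = C(N+1,p+1) T N + sum_(k <= N) C(k,p+1) a k.
>>
    The boundary term is dominated by the tail of the convergent series of
    [C(k,p+1) |a k|]. The sums [F m] of [C(k,m) a k] satisfy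
    [(1 + lambda y) (m+1) F (m+1) = y (1 - m lambda) F m], which is a
    coefficientwise identity, and [F 0] is the degenerate exponential. *)
Require Import Defs.
From Stdlib Require Import Reals Factorial Binomial Lia Lra.
From Coquelicot Require Import Coquelicot.
Open Scope R_scope.

(** * Binomial coefficients that vanish below the diagonal *)

Lemma binom_nonneg (n p : nat) : 0 <= binom n p.
Proof.
unfold binom; destruct (Nat.leb p n); [|lra].
unfold Binomial.C; apply Rdiv_le_0_compat; [apply pos_INR|].
apply Rmult_lt_0_compat; apply INR_fact_lt_0.
Qed.

Lemma binom_0_r (n : nat) : binom n 0 = 1.
Proof.
unfold binom, Binomial.C; simpl Nat.leb; rewrite Nat.sub_0_r; change (INR (fact 0)) with 1.
field; apply INR_fact_neq_0.
Qed.

Lemma binom_absorb (n p : nat) :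
  INR (S p) * binom (S n) (S p) = INR (S n) * binom n p.
Proof.
unfold binom; simpl Nat.leb; destruct (Nat.leb_spec p n) as [H|H]; [|ring].
unfold Binomial.C; rewrite Nat.sub_succ, !fact_simpl, !mult_INR.
field; repeat split; try apply INR_fact_neq_0; apply not_0_INR; lia.
Qed.

(** With the difference taken in the reals, no bound on [n] is needed: at [n = p] the factor
    vanishes, and for [n < p] both coefficients do. *)
Lemma binom_succ_r (n p : nat) :
  INR (S p) * binom n (S p) = (INR n - INR p) * binom n p.
Proof.
unfold binom.
destruct (Nat.leb_spec (S p) n) as [H|H]; destruct (Nat.leb_spec p n) as [H'|H'].
- rewrite pascal_step3 by lia.
  rewrite minus_INR by lia; field; apply not_0_INR; lia.
- lia.
- replace p with n by lia; ring.
- ring.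
Qed.

(** Multiplied by [p + 1], both sides become [(n + 1) C(n,p)], so no case split on [n] and [p] is
    required. *)
Lemma binom_pascal (n p : nat) :
  binom (S n) (S p) = binom n p + binom n (S p).
Proof.
apply Rmult_eq_reg_l with (INR (S p)); [|apply not_0_INR; lia].
rewrite Rmult_plus_distr_l, binom_absorb, binom_succ_r, !S_INR; ring.
Qed.

Lemma binom_le_succ (n p : nat) : binom n p <= binom (S n) p.
Proof.
destruct p as [|p]; [rewrite !binom_0_r; lra|].
rewrite binom_pascal; generalize (binom_nonneg n p); lra.
Qed.

Lemma binom_le_add (n k p : nat) : binom n p <= binom (n + k) p.
Proof.
induction k as [|k IH]; [rewrite Nat.add_0_r; lra|].
rewrite Nat.add_succ_r; apply Rle_trans with (1 := IH), binom_le_succ.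
Qed.

(** * Absolute convergence, tails and summation by parts *)

(** Comparison with a geometric series from index [N] on. The ratio condition is a product
    inequality because terms may be zero: the degenerate exponential is a polynomial when
    [1 / lambda] is a positive integer. *)
Lemma ex_series_abs_eventually_ratio (a : nat -> R) (r : R) (N : nat) :
  0 <= r < 1 ->
  (forall n, (N <= n)%nat -> Rabs (a (S n)) <= r * Rabs (a n)) ->
  ex_series (fun n => Rabs (a n)).
Proof.
intros Hr Ha; apply (ex_series_incr_n _ N).
apply (ex_series_le (V := R_CompleteNormedModule) _
         (fun k => Rabs (a N) * r ^ k)).
- intros k; change (Rabs (Rabs (a (N + k)%nat)) <= Rabs (a N) * r ^ k).
  rewrite Rabs_Rabsolu; induction k as [|k IH].
  + rewrite Nat.add_0_r; simpl; lra.
  + rewrite Nat.add_succ_r.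
    apply Rle_trans with (1 := Ha _ (Nat.le_add_r N k)); simpl; nra.
- apply (ex_series_scal_l (V := R_NormedModule)), ex_series_geom.
  rewrite Rabs_pos_eq; lra.
Qed.

Lemma is_series_tail (a : nat -> R) (N : nat) :
  ex_series a ->
  is_series (fun k => a (S N + k)%nat) (Series a - sum_f_R0 a N).
Proof.
intros Ha.
rewrite (Series_incr_n a (S N)) by (lia || assumption); simpl pred.
replace (sum_f_R0 a N + _ - sum_f_R0 a N)
  with (Series (fun k => a (S N + k)%nat)) by ring.
apply Series_correct, ex_series_incr_n; assumption.
Qed.

Lemma Series_tail_lim (a : nat -> R) :
  ex_series a -> is_lim_seq (fun N => Series a - sum_f_R0 a N) 0.
Proof.
intros Ha; replace (Finite 0) with (Finite (Series a - Series a))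
  by (f_equal; ring).
apply is_lim_seq_minus'; [apply is_lim_seq_const|].
apply is_lim_seq_ext with (sum_n a); [intros n; apply sum_n_Reals|].
exact (Series_correct a Ha).
Qed.

(** A purely algebraic identity, hence the arbitrary [l]. In the inductive step the old tail is the
    new one plus [a (S N)], and Pascal's rule merges the two multiples of the new tail. *)
Lemma sum_binom_tail (a : nat -> R) (l : R) (p N : nat) :
  sum_f_R0 (fun n => binom n p * (l - sum_f_R0 a n)) N
  = binom (S N) (S p) * (l - sum_f_R0 a N)
    + sum_f_R0 (fun k => binom k (S p) * a k) N.
Proof.
induction N as [|N IH].
- simpl; rewrite (binom_pascal 0 p).
  replace (binom 0 (S p)) with 0 by reflexivity; ring.
- rewrite tech5, IH, (binom_pascal (S N) p), !tech5; ring.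
Qed.

Lemma is_series_binom_tail (a : nat -> R) (p : nat) :
  ex_series (fun k => Rabs (a k)) ->
  ex_series (fun k => Rabs (binom k (S p) * a k)) ->
  is_series (fun n => binom n p * (Series a - sum_f_R0 a n))
            (Series (fun k => binom k (S p) * a k)).
Proof.
intros Ha Hb.
set (b := fun k => binom k (S p) * a k).
change (ex_series (fun k => Rabs (b k))) in Hb.
assert (Hbound : is_lim_seq
  (fun N => binom (S N) (S p) * (Series a - sum_f_R0 a N)) 0).
{ apply is_lim_seq_abs_0, is_lim_seq_le_le with (u := fun _ => 0)
    (w := fun N => Series (fun k => Rabs (b k))
                   - sum_f_R0 (fun k => Rabs (b k)) N).
  - intros N; split; [apply Rabs_pos|].
    pose proof (is_series_tail a N (ex_series_Rabs a Ha)) as Ta.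
    pose proof (is_series_tail _ N Hb) as Tb.
    rewrite <- (is_series_unique _ _ Ta), <- (is_series_unique _ _ Tb).
    rewrite <- Series_scal_l.
    (* [binom] grows with its upper index, so the fixed weight at [S N] is at most the weight
       carried by each term of the tail. *)
    assert (Hle : forall k,
      0 <= Rabs (binom (S N) (S p) * a (S N + k)%nat)
        <= Rabs (b (S N + k)%nat)).
    { intros k; split; [apply Rabs_pos|]; unfold b; rewrite !Rabs_mult.
      apply Rmult_le_compat_r; [apply Rabs_pos|].
      rewrite !Rabs_pos_eq by apply binom_nonneg; apply binom_le_add. }
    apply Rle_trans with
      (Series (fun k => Rabs (binom (S N) (S p) * a (S N + k)%nat))).
    + apply Series_Rabs.
      apply (ex_series_le (V := R_CompleteNormedModule) _
               (fun k => Rabs (b (S N + k)%nat))); [|eexists; exact Tb].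
      intros k; change norm with Rabs; cbv beta.
      rewrite Rabs_Rabsolu; apply Hle.
    + apply Series_le; [exact Hle | eexists; exact Tb].
  - apply is_lim_seq_const.
  - apply Series_tail_lim, Hb. }
change (is_lim_seq (sum_n (fun n => binom n p * (Series a - sum_f_R0 a n)))
                   (Series b)).
apply is_lim_seq_ext with
  (fun N => binom (S N) (S p) * (Series a - sum_f_R0 a N) + sum_f_R0 b N).
- intros N; rewrite sum_n_Reals, sum_binom_tail; reflexivity.
- replace (Series b) with (0 + Series b) by ring.
  apply is_lim_seq_plus'; [exact Hbound|].
  apply is_lim_seq_ext with (sum_n b); [intros n; apply sum_n_Reals|].
  exact (Series_correct b (ex_series_Rabs b Hb)).
Qed.

(** * The binomially weighted degenerate exponential series *)

Lemma deg_exp_coef_succ (lambda : R) (n : nat) :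
  INR (S n) * deg_exp_coef lambda (S n)
  = (1 - INR n * lambda) * deg_exp_coef lambda n.
Proof.
unfold deg_exp_coef; rewrite fact_simpl, mult_INR; simpl gen_falling.
field; split; [apply INR_fact_neq_0 | apply not_0_INR; lia].
Qed.

(** The ratio of consecutive terms with denominators cleared. Both [(k+1-m) C(k+1,m)] and
    [(k+1) C(k,m)] equal [(m+1) C(k+1,m+1)]. *)
Lemma binom_deg_exp_term_succ (lambda y : R) (m k : nat) :
  (INR (S k) - INR m)
    * (binom (S k) m * (deg_exp_coef lambda (S k) * y ^ S k))
  = y * (1 - INR k * lambda)
    * (binom k m * (deg_exp_coef lambda k * y ^ k)).
Proof.
transitivity (INR (S m) * binom (S k) (S m)
                * (deg_exp_coef lambda (S k) * y ^ S k)).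
- rewrite binom_succ_r; ring.
- rewrite binom_absorb; simpl pow.
  transitivity (INR (S k) * deg_exp_coef lambda (S k)
                  * (binom k m * (y * y ^ k))); [ring|].
  rewrite deg_exp_coef_succ; ring.
Qed.

Lemma ex_series_abs_binom_deg_exp (lambda y : R) (m : nat) :
  Rabs (lambda * y) < 1 ->
  ex_series (fun k =>
    Rabs (binom k m * (deg_exp_coef lambda k * y ^ k))).
Proof.
intros Hq; set (q := Rabs (lambda * y)) in *.
assert (Hq0 : 0 <= q) by apply Rabs_pos.
(* The term ratios are bounded by [(|y| + k q) / (k + 1 - m)], which tends to [q]; [r] is the
   midpoint of [q] and 1. Since [r - q = (1 - q) / 2], the [N] below ensures
   [|y| + k q <= r (k + 1 - m)] for [k > N]. Starting at [S N + m] also keeps [k + 1 - m]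
   positive. *)
set (r := (1 + q) / 2).
destruct (nfloor_ex ((Rabs y + r * INR m) / ((1 - q) / 2))) as [N [_ HN]].
{ apply Rdiv_le_0_compat; [|lra].
  apply Rplus_le_le_0_compat; [apply Rabs_pos|].
  apply Rmult_le_pos; [unfold r; lra | apply pos_INR]. }
apply (ex_series_abs_eventually_ratio _ r (S N + m)); [unfold r; lra|].
intros k Hk.
assert (Hkm : INR m <= INR k) by (apply le_INR; lia).
assert (HNk : INR N + 1 <= INR k) by (rewrite <- S_INR; apply le_INR; lia).
assert (Hd : 0 < INR (S k) - INR m) by (rewrite S_INR; lra).
apply Rmult_le_reg_l with (1 := Hd).
rewrite <- (Rabs_pos_eq (INR (S k) - INR m)) at 1 by lra.
rewrite <- Rabs_mult, binom_deg_exp_term_succ, Rabs_mult, <- (Rmult_assoc _ r).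
apply Rmult_le_compat_r; [apply Rabs_pos|].
apply Rlt_div_l in HN; [|lra].
apply Rle_trans with (Rabs y + INR k * q).
- replace (y * (1 - INR k * lambda)) with (y + - (INR k * (lambda * y))) by ring.
  apply Rle_trans with (1 := Rabs_triang _ _).
  rewrite Rabs_Ropp, Rabs_mult, (Rabs_pos_eq (INR k)) by apply pos_INR.
  apply Rle_refl.
- rewrite S_INR; unfold r in *; nra.
Qed.

Lemma Series_binom_deg_exp_succ (lambda y : R) (m : nat) :
  Rabs (lambda * y) < 1 ->
  (1 + lambda * y) * INR (S m)
    * Series (fun k => binom k (S m) * (deg_exp_coef lambda k * y ^ k))
  = y * (1 - INR m * lambda)
    * Series (fun k => binom k m * (deg_exp_coef lambda k * y ^ k)).
Proof.
intros Hq.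
pose proof (ex_series_Rabs _ (ex_series_abs_binom_deg_exp lambda y (S m) Hq))
  as E.
set (b := fun k => binom k (S m) * (deg_exp_coef lambda k * y ^ k)) in *.
(* The term of index 0 vanishes, so shifting the index loses nothing. *)
assert (Hshift : Series b = Series (fun k => b (S k))).
{ rewrite (Series_incr_1 b E); unfold b at 1.
  replace (binom 0 (S m)) with 0 by reflexivity; ring. }
transitivity (INR (S m) * Series (fun k => b (S k))
              + lambda * y * INR (S m) * Series b).
{ rewrite <- Hshift; ring. }
rewrite <- !Series_scal_l, <- Series_plus.
- apply Series_ext; intros k; unfold b.
  transitivity
    (INR (S m) * binom (S k) (S m) * (deg_exp_coef lambda (S k) * y ^ S k)
     + lambda * y * (INR (S m) * binom k (S m))
       * (deg_exp_coef lambda k * y ^ k)); [ring|].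
  (* The dependence on [k] cancels: [(1 - k lambda) + lambda (k - m) = 1 - m lambda]. *)
  rewrite binom_absorb, binom_succ_r; simpl pow.
  transitivity
    (INR (S k) * deg_exp_coef lambda (S k) * (binom k m * (y * y ^ k))
     + lambda * y * ((INR k - INR m) * binom k m)
       * (deg_exp_coef lambda k * y ^ k)); [ring|].
  rewrite deg_exp_coef_succ; ring.
- apply (ex_series_scal_l (V := R_NormedModule)), (proj1 (ex_series_incr_1 b)), E.
- apply (ex_series_scal_l (V := R_NormedModule)), E.
Qed.

(** The left side is [y^m / m!] times the [m]-th derivative of the degenerate exponential at [y];
    the closed form comes from iterating the recurrence in [m]. *)
Lemma Series_binom_deg_exp (lambda y : R) (m : nat) :
  Rabs (lambda * y) < 1 ->
  Series (fun k => binom k m * (deg_exp_coef lambda k * y ^ k))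
  = y ^ m / INR (fact m) * gen_falling 1 lambda m
    * / (1 + lambda * y) ^ m * deg_exp lambda y.
Proof.
intros Hq.
assert (H1 : 1 + lambda * y <> 0).
{ apply Rabs_def2 in Hq; lra. }
induction m as [|m IH].
- simpl; unfold deg_exp.
  rewrite (Series_ext _ (fun k => deg_exp_coef lambda k * y ^ k)).
  + field.
  + intros k; rewrite binom_0_r; ring.
- assert (Hm : INR (S m) <> 0) by (apply not_0_INR; lia).
  apply Rmult_eq_reg_l with ((1 + lambda * y) * INR (S m)).
  + rewrite Series_binom_deg_exp_succ, IH by exact Hq.
    rewrite fact_simpl, mult_INR; simpl pow; simpl gen_falling.
    field; repeat split; try assumption;
      [apply pow_nonzero, H1 | apply INR_fact_neq_0].
  + apply Rmult_integral_contrapositive_currified; assumption.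
Qed.

Theorem theorem2p3 (p : nat) (lambda : R) :
  (forall y : R, Rabs (lambda * y) < 1 ->
     is_series (fun n : nat => binom n p * deg_exp_tail lambda y n)
       (y ^ (p + 1) / INR (fact (p + 1)) * gen_falling 1 lambda (p + 1)
          * / (1 + lambda * y) ^ (p + 1) * deg_exp lambda y))
  /\
  (Rabs lambda < 1 ->
     is_series
       (fun n : nat => binom n p *
          (deg_exp lambda 1
             - sum_f_R0 (fun k => gen_falling 1 lambda k / INR (fact k)) n))
       (gen_falling 1 lambda (p + 1) / INR (fact (p + 1))
          * / (1 + lambda) ^ (p + 1) * deg_exp lambda 1)).
Proof.
assert (Hgen : forall y : R, Rabs (lambda * y) < 1 ->
     is_series (fun n : nat => binom n p * deg_exp_tail lambda y n)
       (y ^ (p + 1) / INR (fact (p + 1)) * gen_falling 1 lambda (p + 1)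
          * / (1 + lambda * y) ^ (p + 1) * deg_exp lambda y)).
{ intros y Hq; rewrite Nat.add_1_r, <- Series_binom_deg_exp by exact Hq.
  apply is_series_binom_tail.
  (* With [m = 0] all weights are 1, which gives absolute convergence of the exponential series
     itself. *)
  - apply ex_series_ext with (2 := ex_series_abs_binom_deg_exp lambda y 0 Hq).
    intros k; rewrite binom_0_r, Rmult_1_l; reflexivity.
  - apply ex_series_abs_binom_deg_exp, Hq. }
split; [exact Hgen|].
intros Hl; specialize (Hgen 1); rewrite Rmult_1_r in Hgen.
specialize (Hgen Hl).
replace (gen_falling 1 lambda (p + 1) / INR (fact (p + 1)))
  with (1 ^ (p + 1) / INR (fact (p + 1)) * gen_falling 1 lambda (p + 1))
  by (rewrite pow1; field; apply INR_fact_neq_0).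
apply is_series_ext with (2 := Hgen).
intros n; unfold deg_exp_tail; do 2 f_equal.
apply sum_eq; intros k _; rewrite pow1; apply Rmult_1_r.
Qed.
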